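(* Let $\mathcal V$ be a unital commutative associative algebra with an automorphism $S$, and let the pseudodifference operator $L(S)\in\mathcal V((S^{-1}))$ or $L(S)\in\mathcal V((S))$ satisfy the multiplicative Adler identity $$\{L(z)_\lambda L(w)\}=L(w\lambda S)\,\delta_+\Big(\frac{w\lambda S}{z}\Big)L^*\Big(\frac{\lambda}{z}\Big)-L(z)\,\delta_+\Big(\frac{w\lambda S}{z}\Big)L(w)-\frac12\big(L(w\lambda S)+L(w)\big)\Big(L^*\Big(\frac\lambda z\Big)-L(z)\Big)$$ with respect to a multiplicative $\lambda$-bracket $\{\cdot\,_\lambda\,\cdot\}$ of $\mathcal V$. Let $\mathcal U\subset\mathcal V$ be the smallest subalgebra of $\mathcal V$ containing all the coefficients of $L(z)$ and preserved by the automorphism $S$. Then $\mathcal U$ is a subalgebra with respect to the multiplicative $\lambda$-bracket, i.e. $\{\mathcal U_\lambda\,\mathcal U\}\subset\mathcal U[\lambda,\lambda^{-1}]$, and the restriction of $\{\cdot\,_\lambda\,\cdot\}$ to $\mathcal U$ defines a structure of a multiplicative Poisson vertex algebra on $\mathcal U$. If, in particular, $\mathcal V$ is generated by the coefficients of $L(z)$ and the action of $S$, then $\mathcal V$ is a multiplicative Poisson vertex algebra.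
   Context: The base field $\mathbb F$ has characteristic $0$. A multiplicative $\lambda$-bracket on $\mathcal V$ is a linear map $\mathcal V\otimes\mathcal V\to\mathcal V[\lambda,\lambda^{-1}]$, $a\otimes b\mapsto\{a_\lambda b\}$, satisfying: sesquilinearity $\{S(a)_\lambda b\}=\lambda^{-1}\{a_\lambda b\}$, $\{a_\lambda S(b)\}=\lambda S\{a_\lambda b\}$ ($S$ acting on coefficients); left Leibniz rule $\{a_\lambda bc\}=\{a_\lambda b\}c+\{a_\lambda c\}b$; right Leibniz rule $\{ab_\lambda c\}=\sum_n\big(p_nS^n(b)+q_nS^n(a)\big)\lambda^n$, where $\{a_\lambda c\}=\sum_np_n\lambda^n$ and $\{b_\lambda c\}=\sum_nq_n\lambda^n$. It is a multiplicative Poisson vertex algebra structure if, in addition: (skewsymmetry) $\{b_\lambda a\}=-\sum_nS^{-n}(c_n)\lambda^{-n}$ whenever $\{a_\lambda b\}=\sum_nc_n\lambda^n$; (Jacobi identity) $\{a_\lambda\{b_\mu c\}\}-\{b_\mu\{a_\lambda c\}\}=\{\{a_\lambda b\}_{\lambda\mu}c\}$. $\mathcal V((S^{\pm1}))$ means $\mathcal V((S))$ or $\mathcal V((S^{-1}))$, with coefficients on the left and product determined by $S\circ f=S(f)S$, $f\in\mathcal V$. For $L(S)=\sum_nu_nS^n$, the symbol is $L(z)=\sum_nu_nz^n$, the formal adjoint is $L^*(S)=\sum_nS^{-n}\circ u_n$, and $\delta_+(x)=\sum_{k\ge0}x^k$. In the Adler identity: $L(w\lambda S)=\sum_nu_nw^n\lambda^nS^n$,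 $L^*(\lambda/z)=\sum_nS^{-n}(u_n)\lambda^{-n}z^n$, $\delta_+(w\lambda S/z)=\sum_{k\ge0}w^k\lambda^kz^{-k}S^k$, and each $S$ acts on all coefficients written to its right. The left-hand side is $\{L(z)_\lambda L(w)\}=\sum_{i,j}\{{u_i}_\lambda u_j\}z^iw^j$. *)

(* Defs.v *)
From HB Require Import structures.
From mathcomp Require Import all_boot all_order all_algebra finmap.
From mathcomp Require Import boolp classical_sets fsbigop.

Set Implicit Arguments.
Unset Strict Implicit.
Unset Printing Implicit Defensive.
Import GRing.Theory.
Local Open Scope ring_scope.

Record algAut (F : fieldType) (V : comAlgType F) := AlgAut {
  aut_fun :> {lrmorphism V -> V};
  aut_inv : V -> V;
  aut_funK : cancel aut_fun aut_inv;
  aut_invK : cancel aut_inv aut_fun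
}.

Definition aut_pow (F : fieldType) (V : comAlgType F) (S : algAut V) (n : int)
    : V -> V :=
  match n with
  | Posz m => iter m S
  | Negz m => iter m.+1 (aut_inv S)
  end.

(* Laurent polynomials V[lambda, lambda^-1]: p n is the coefficient of
   lambda^n. *)
Definition laurent (V : zmodType) := {fsfun int -> V with 0}.

Section LambdaBracket.
Variables (F : fieldType) (V : comAlgType F) (S : algAut V).
Variable br : V -> V -> laurent V.

(* br a b n is the coefficient of lambda^n in {a_lambda b}; all axioms are
   equalities of Laurent polynomials, written coefficient by coefficient. *)
Record is_lambda_bracket : Prop := IsLambdaBracket {
  br_linearl : forall (k : F) a a' b n,
    br (k *: a + a') b n = k *: br a b n + br a' b n;
  br_linearr : forall (k : F) a b b' n,
    br a (k *: b + b') n = k *: br a b n + br a b' n;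
  br_sesquil : forall a b n, br (S a) b n = br a b (n + 1);
  br_sesquir : forall a b n, br a (S b) n = S (br a b (n - 1));
  br_leibnizl : forall a b c n,
    br a (b * c) n = br a b n * c + br a c n * b;
  br_leibnizr : forall a b c n,
    br (a * b) c n =
      br a c n * aut_pow S n b + br b c n * aut_pow S n a
}.

(* In the Jacobi identity one compares the coefficients of lambda^m mu^n.  If
   {a_lambda b} = \sum_k c_k lambda^k then {{a_lambda b}_(lambda mu) c} is
   \sum_k lambda^k {(c_k)_(lambda mu) c}, in which lambda^m mu^n only arises
   for k = m - n. *)
Record is_mult_PVA : Prop := IsMultPVA {
  mPVA_bracket : is_lambda_bracket;
  mPVA_skew : forall a b n, br b a n = - aut_pow S n (br a b (- n));
  mPVA_jacobi : forall a b c m n,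
    br a (br b c n) m - br b (br a c m) n = br (br a b (m - n)) c n
}.

End LambdaBracket.

(* A family u : int -> V stands for \sum_n u_n S^n. *)
Definition in_laurent_S (V : zmodType) (u : int -> V) : Prop :=
  exists N : int, forall n : int, n < N -> u n = 0.

Definition in_laurent_Sinv (V : zmodType) (u : int -> V) : Prop :=
  exists N : int, forall n : int, N < n -> u n = 0.

Section Adler.
Variables (F : fieldType) (V : comAlgType F) (S : algAut V) (u : int -> V).

(* Formal distributions in z, w, lambda: f i j l is the coefficient of
   z^i w^j lambda^l. *)
Definition distr3 := int -> int -> int -> V.

Definition symb_z : distr3 := fun i j l =>
  if (j == 0) && (l == 0) then u i else 0.

Definition symb_w : distr3 := fun i j l =>
  if (i == 0) && (l == 0) then u j else 0.

(* L^*(lambda/z) = \sum_n S^(-n)(u_n) lambda^(-n) z^n *)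
Definition adj_lambda_z : distr3 := fun i j l =>
  if (j == 0) && (l == - i) then aut_pow S (- i) (u i) else 0.

(* The action on a distribution of, respectively, L(z), L(w), L(w lambda S)
   and delta_+(w lambda S / z).  On the distributions occurring in the Adler
   identity each of these sums has at most one nonzero term. *)
Definition mul_Lz (f : distr3) : distr3 := fun i j l =>
  \sum_(n \in [set: int]%classic) (u n * f (i - n) j l).

Definition mul_Lw (f : distr3) : distr3 := fun i j l =>
  \sum_(n \in [set: int]%classic) (u n * f i (j - n) l).

Definition act_LwlS (f : distr3) : distr3 := fun i j l =>
  \sum_(n \in [set: int]%classic)
    (u n * aut_pow S n (f i (j - n) (l - n))).

Definition act_delta (f : distr3) : distr3 := fun i j l =>
  \sum_(k \in [set: nat]%classic)
    aut_pow S k%:Z (f (i + k%:Z) (j - k%:Z) (l - k%:Z)).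

Definition adler_rhs : distr3 := fun i j l =>
  let g : distr3 := fun i j l => adj_lambda_z i j l - symb_z i j l in
  act_LwlS (act_delta adj_lambda_z) i j l
  - mul_Lz (act_delta symb_w) i j l
  - (2%:R : F)^-1 *: (act_LwlS g i j l + mul_Lw g i j l).

Definition adler_identity (br : V -> V -> laurent V) : Prop :=
  forall i j l : int, br (u i) (u j) l = adler_rhs i j l.

End Adler.

Section GeneratedSubalgebra.
Variables (F : fieldType) (V : comAlgType F) (S : algAut V) (u : int -> V).

(* Preserved by the automorphism S is read as S(A) = A, so that S restricts to
   an automorphism of A; subalgebras are unital. *)
Definition S_subalg_containing (A : {pred V}) : Prop :=
  [/\ GRing.subalg_closed A,
      forall x, (S x \in A) = (x \in A) &
      forall n, u n \in A].

Definition gen_subalg : {pred V} := fun x =>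
  `[< forall A : {pred V}, S_subalg_containing A -> x \in A >].

Lemma gen_subalgP x :
  reflect (forall A : {pred V}, S_subalg_containing A -> x \in A)
          (x \in gen_subalg).
Proof. exact: asboolP. Qed.

Lemma gen_subalg_closed : GRing.subalg_closed gen_subalg.
Proof.
split.
- by apply/gen_subalgP => A [[]].
- move=> k x y /gen_subalgP xA /gen_subalgP yA; apply/gen_subalgP => A hA.
  by have [[_ linA _] _ _] := hA; apply: linA; [exact: xA | exact: yA].
- move=> x y /gen_subalgP xA /gen_subalgP yA; apply/gen_subalgP => A hA.
  by have [[_ _ mulA] _ _] := hA; apply: mulA; [exact: xA | exact: yA].
Qed.

Lemma gen_subalg_S x : (S x \in gen_subalg) = (x \in gen_subalg).
Proof.
apply/gen_subalgP/gen_subalgP => xA A hA; have [_ SA _] := hA.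
  by rewrite -SA; apply: xA.
by rewrite SA; apply: xA.
Qed.

HB.instance Definition _ :=
  GRing.isSubalgClosed.Build F V gen_subalg gen_subalg_closed.

Record gen_type := GenType {
  gen_val : V;
  gen_valP : gen_val \in gen_subalg
}.

HB.instance Definition _ := [isSub for gen_val].
HB.instance Definition _ := [Choice of gen_type by <:].
HB.instance Definition _ := [SubChoice_isSubComNzRing of gen_type by <:].
HB.instance Definition _ := [SubZmodule_isSubLmodule of gen_type by <:].
HB.instance Definition _ :=
  [SubNzRing_SubLmodule_isSubLalgebra of gen_type by <:].
HB.instance Definition _ := [SubLalgebra_isSubAlgebra of gen_type by <:].

Lemma gen_subalg_Sinv x : (aut_inv S x \in gen_subalg) = (x \in gen_subalg).
Proof. by rewrite -gen_subalg_S aut_invK. Qed.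

Definition gen_S (x : gen_type) : gen_type :=
  GenType (etrans (gen_subalg_S (val x)) (valP x)).

Definition gen_Sinv (x : gen_type) : gen_type :=
  GenType (etrans (gen_subalg_Sinv (val x)) (valP x)).

Lemma gen_S_zmod : zmod_morphism gen_S.
Proof. by move=> x y; apply/val_inj; rewrite /= raddfB. Qed.

Lemma gen_S_scalable : scalable gen_S.
Proof. by move=> k x; apply/val_inj; rewrite /= linearZ. Qed.

Lemma gen_S_monoid : monoid_morphism gen_S.
Proof.
split; first by apply/val_inj; rewrite /= rmorph1.
by move=> x y; apply/val_inj; rewrite /= rmorphM.
Qed.

HB.instance Definition _ :=
  GRing.isZmodMorphism.Build gen_type gen_type gen_S gen_S_zmod.
HB.instance Definition _ :=
  GRing.isMonoidMorphism.Build gen_type gen_type gen_S gen_S_monoid.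
HB.instance Definition _ :=
  GRing.isScalable.Build F gen_type gen_type *:%R gen_S gen_S_scalable.

Lemma gen_SK : cancel gen_S gen_Sinv.
Proof. by move=> x; apply/val_inj; rewrite /= aut_funK. Qed.

Lemma gen_SinvK : cancel gen_Sinv gen_S.
Proof. by move=> x; apply/val_inj; rewrite /= aut_invK. Qed.

Definition gen_aut : algAut gen_type :=
  @AlgAut F gen_type gen_S gen_Sinv gen_SK gen_SinvK.

End GeneratedSubalgebra.

(* Main.v *)
(** The Adler identity says that
      {u_i _lambda u_j} = 1/2 \sum_l lambda^l
        ((sgn (j - i - l) - sgn l) u_(i+l) S^l(u_(j-l))
         + ([l = j] - [l = -i]) u_j S^l(u_i)),
    from which skewsymmetry on the generators is immediate.  In the Jacobi
    identity for u_i, u_j, u_k only six kinds of cubic monomials occur; four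
    coefficients cancel formally, and the two others reduce to
      sgn x sgn y - sgn (x + y) (sgn x + sgn y) = [x = y = 0] - 1,
    leaving boundary terms of opposite signs, supported on indices for which
    the two monomials coincide.  Both axioms then spread from the generators to
    the subalgebra by the Leibniz rules; Jacobi in the first argument uses
    skewsymmetry, and the second argument is reduced to the first one by
    exchanging the two. *)
Require Import Defs.
From HB Require Import structures.
From mathcomp Require Import all_boot all_order all_algebra finmap.
From mathcomp Require Import boolp classical_sets fsbigop.
From mathcomp Require Import ring zify.
Set Implicit Arguments.
Unset Strict Implicit.
Unset Printing Implicit Defensive.
Import Order.TTheory GRing.Theory Num.Theory.
Local Open Scope ring_scope.

(** * Integer powers of [S] as algebra morphisms *)

Section AutPow.
Variables (F : fieldType) (V : comAlgType F) (S : algAut V).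

(** Treats both signs of the exponent at once: a property stable under composition with [S] and with
    its inverse passes to every power. *)
Lemma aut_pow_ind (P : (V -> V) -> Prop) :
    P id -> (forall f, P f -> P (S \o f)) ->
    (forall f, P f -> P (aut_inv S \o f)) ->
  forall n, P (aut_pow S n).
Proof.
move=> P0 PS PSinv [] n; first by elim: n => [|n /PS].
by elim: n => [|n /PSinv//]; exact: PSinv.
Qed.

Lemma aut_pow_zmod n : zmod_morphism (aut_pow S n).
Proof.
pattern (aut_pow S n); apply: aut_pow_ind => //= f fB x y /=; rewrite fB.
  by rewrite raddfB.
(* [aut_inv S] is a bare function; its additivity is read off after applying the injective [S]. *)
by apply: (can_inj (aut_funK S)); rewrite raddfB /= !aut_invK.
Qed.

Lemma aut_pow_monoid n : monoid_morphism (aut_pow S n).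
Proof.
pattern (aut_pow S n); apply: aut_pow_ind => //= f [f1 fM];
  split=> [|x y] /=; rewrite ?f1 ?fM.
- by rewrite rmorph1.
- by rewrite rmorphM.
- by apply: (can_inj (aut_funK S)); rewrite rmorph1 aut_invK.
- by apply: (can_inj (aut_funK S)); rewrite rmorphM /= !aut_invK.
Qed.

Lemma aut_pow_scalable n : scalable (aut_pow S n).
Proof.
pattern (aut_pow S n); apply: aut_pow_ind => //= f fZ k x /=; rewrite fZ.
  by rewrite linearZ.
by apply: (can_inj (aut_funK S)); rewrite linearZ /= !aut_invK.
Qed.

HB.instance Definition _ n :=
  GRing.isZmodMorphism.Build V V (aut_pow S n) (aut_pow_zmod n).
HB.instance Definition _ n :=
  GRing.isMonoidMorphism.Build V V (aut_pow S n) (aut_pow_monoid n).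
HB.instance Definition _ n :=
  GRing.isScalable.Build F V V *:%R (aut_pow S n) (aut_pow_scalable n).

Lemma aut_pow_succ n x : aut_pow S (n + 1) x = S (aut_pow S n x).
Proof.
case: n => n; first by rewrite -PoszD addn1.
case: n => [|n]; first by rewrite /aut_pow /= aut_invK.
have -> : Negz n.+1 + 1 = Negz n by lia.
by rewrite /aut_pow /= aut_invK.
Qed.

Lemma aut_pow_pred n x : aut_pow S (n - 1) x = aut_inv S (aut_pow S n x).
Proof. by rewrite -[in RHS](subrK 1 n) aut_pow_succ aut_funK. Qed.

Lemma aut_pow0 x : aut_pow S 0 x = x.
Proof. by []. Qed.

Lemma aut_powD m n x : aut_pow S (m + n) x = aut_pow S m (aut_pow S n x).
Proof.
elim: m => [|m IHm|m IHm]; first by rewrite add0r.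
- by rewrite -addn1 PoszD addrAC !aut_pow_succ IHm.
- have -> : - m.+1%:Z = - m%:Z - 1 by lia.
  by rewrite addrAC !aut_pow_pred IHm.
Qed.

End AutPow.

Arguments aut_pow : simpl never.

(** * Elementary consequences of the bracket axioms *)

Section BracketTheory.
Variables (F : fieldType) (V : comAlgType F) (S : algAut V).
Variables (br : V -> V -> laurent V) (br_lambda : is_lambda_bracket S br).

Lemma brDr a b b' (n : int) : br a (b + b') n = br a b n + br a b' n.
Proof. by have := br_linearr br_lambda 1 a b b' n; rewrite !scale1r. Qed.

Lemma brDl a a' b (n : int) : br (a + a') b n = br a b n + br a' b n.
Proof. by have := br_linearl br_lambda 1 a a' b n; rewrite !scale1r. Qed.

Lemma br0r a (n : int) : br a 0 n = 0.
Proof. by apply: (addrI (br a 0 n)); rewrite -brDr !addr0. Qed.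

Lemma br0l b (n : int) : br 0 b n = 0.
Proof. by apply: (addrI (br 0 b n)); rewrite -brDl !addr0. Qed.

Lemma brZr k a b (n : int) : br a (k *: b) n = k *: br a b n.
Proof. by have := br_linearr br_lambda k a b 0 n; rewrite br0r !addr0. Qed.

Lemma brZl k a b (n : int) : br (k *: a) b n = k *: br a b n.
Proof. by have := br_linearl br_lambda k a 0 b n; rewrite br0l !addr0. Qed.

Lemma brNl a b (n : int) : br (- a) b n = - br a b n.
Proof. by rewrite -scaleN1r brZl scaleN1r. Qed.

Lemma br1r a (n : int) : br a 1 n = 0.
Proof.
have := br_leibnizl br_lambda a 1 1 n; rewrite !mulr1 => e.
by apply: (addrI (br a 1 n)); rewrite addr0 -e.
Qed.

Lemma br1l b (n : int) : br 1 b n = 0.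
Proof.
have := br_leibnizr br_lambda 1 1 b n; rewrite rmorph1 !mulr1 => e.
by apply: (addrI (br 1 b n)); rewrite addr0 -e.
Qed.

Lemma br_aut_powl p a b (n : int) : br (aut_pow S p a) b n = br a b (n + p).
Proof.
elim: p n => [|p IHp|p IHp] n; first by rewrite addr0.
- rewrite -addn1 PoszD aut_pow_succ (br_sesquil br_lambda) IHp.
  by rewrite -addrA [1 + _]addrC.
- have -> : n + - p.+1%:Z = n - 1 + - p%:Z by lia.
  rewrite -IHp -[X in br _ _ X](subrK 1) -(br_sesquil br_lambda).
  by rewrite -aut_pow_succ; congr (br (aut_pow S _ a) b _); lia.
Qed.

Lemma br_aut_powr p a b (n : int) :
  br a (aut_pow S p b) n = aut_pow S p (br a b (n - p)).
Proof.
elim: p n => [|p IHp|p IHp] n; first by rewrite subr0.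
- rewrite -addn1 PoszD !aut_pow_succ (br_sesquir br_lambda) IHp.
  by congr (S (aut_pow S _ (br a b _))); lia.
- apply: (can_inj (aut_funK S)).
  have := br_sesquir br_lambda a (aut_pow S (- p.+1%:Z) b) (n + 1).
  rewrite addrK => <-; rewrite -!aut_pow_succ.
  have -> : - p.+1%:Z + 1 = - p%:Z by lia.
  by rewrite IHp; congr (aut_pow S _ (br a b _)); lia.
Qed.

End BracketTheory.

(** * The Adler identity in coefficients, each sum collapsing to one term *)

Lemma fsbig_point (T : choiceType) (V : nmodType) (x : T) (f : T -> V) :
  (forall y, y != x -> f y = 0) ->
  \sum_(y \in [set: T]%classic) f y = f x.
Proof.
move=> f0; rewrite (fsbigTE [fset x]%fset) ?big_seq_fset1 // => y.
by rewrite inE => /f0.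
Qed.

Section AdlerFormula.
Variables (F : fieldType) (V : comAlgType F) (S : algAut V) (u : int -> V).

Lemma act_delta_adj i j l :
  act_delta S (adj_lambda_z S u) i j l =
  if (0 <= j) && (l == - i) then aut_pow S (- i) (u (i + j)) else 0.
Proof.
(* The adjoint symbol is free of w, so only k = j contributes, and nothing does when j < 0. *)
rewrite /act_delta /adj_lambda_z; case: j => j; last first.
  by rewrite /= fsbig1 // => k _; rewrite ifF ?raddf0 //; lia.
rewrite (fsbig_point (x := j)) => [|k kj]; last by rewrite ifF ?raddf0 //; lia.
rewrite subrr eqxx /=; have -> : (l - j%:Z == - (i + j%:Z)) = (l == - i) by lia.
by case: eqP => _; rewrite ?raddf0 // -aut_powD; congr (aut_pow _ _ _); lia.
Qed.

Lemma act_delta_symb_w i j l :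
  act_delta S (symb_w u) i j l =
  if (0 <= l) && (l == - i) then aut_pow S l (u (j - l)) else 0.
Proof.
(* Here the symbol is free of lambda, so k = l is forced. *)
rewrite /act_delta /symb_w; case: l => l; last first.
  by rewrite /= fsbig1 // => k _; rewrite ifF ?raddf0 //; lia.
rewrite (fsbig_point (x := l)) => [|k kj]; last by rewrite ifF ?raddf0 //; lia.
rewrite subrr eqxx andbT /=; have -> : (i + l%:Z == 0) = (l%:Z == - i) by lia.
by case: eqP => _; rewrite ?raddf0.
Qed.

Lemma adler_rhsE i j l : adler_rhs S u i j l =
  (i + l <= j)%R%:R * (u (i + l) * aut_pow S l (u (j - l)))
  - (0 <= l)%R%:R * (u (i + l) * aut_pow S l (u (j - l)))
  - (2%:R : F)^-1 *:
    (((l == j - i)%R%:R - (l == j)%R%:R) * (u j * aut_pow S l (u i))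
    + ((l == - i)%R%:R - (l == 0)%R%:R) * (u j * aut_pow S l (u i))).
Proof.
rewrite /adler_rhs; congr (_ - _ - _ *: (_ + _)).
(* The inner factor is supported where its lambda-exponent l - n equals -i, hence n = i + l. *)
- rewrite /act_LwlS (fsbig_point (x := i + l)) => [|n nil]; last first.
    by rewrite act_delta_adj ifF ?raddf0 ?mulr0 //; lia.
  rewrite act_delta_adj.
  have -> : (l - (i + l) == - i) by lia.
  have -> : (0 <= j - (i + l)) = (i + l <= j) by lia.
  rewrite andbT; case: ifP => _; rewrite ?raddf0 ?mulr0 ?mul0r // mul1r.
  by rewrite -aut_powD; congr (_ * aut_pow _ _ (u _)); lia.
- rewrite /mul_Lz (fsbig_point (x := i + l)) => [|n nil]; last first.
    by rewrite act_delta_symb_w ifF ?mulr0 //; lia.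
  rewrite act_delta_symb_w; have -> : (l == - (i - (i + l))) by lia.
  by rewrite andbT; case: ifP => _; rewrite ?mulr0 ?mul0r ?mul1r.
- rewrite /act_LwlS (fsbig_point (x := j)) => [|n nil]; last first.
    rewrite /adj_lambda_z /symb_z !ifF ?subrr ?raddf0 ?mulr0 //; lia.
  rewrite /adj_lambda_z /symb_z subrr eqxx /=.
  have -> : (l - j == - i) = (l == j - i) by lia.
  have -> : (l - j == 0) = (l == j) by lia.
  rewrite mulrBl raddfB mulrBr /=; congr (_ - _); case: eqP => [->|_];
    rewrite ?raddf0 ?mulr0 ?mul0r ?mul1r //.
  by rewrite -aut_powD.
- rewrite /mul_Lw (fsbig_point (x := j)) => [|n nil]; last first.
    rewrite /adj_lambda_z /symb_z !ifF ?subrr ?mulr0 //; lia.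
  rewrite /adj_lambda_z /symb_z subrr eqxx /= mulrBl mulrBr.
  by congr (_ - _); case: eqP => [->|_]; rewrite ?mulr0 ?mul0r ?mul1r.
Qed.

Definition sgn_coef (i j l : int) : int := sgz (j - i - l) - sgz l.
Definition diag_coef (i j l : int) : int := (l == j)%:Z - (l == - i)%:Z.

Hypothesis two_neq0 : (2%:R : F) != 0.

(* With sgn 0 = 0, the two half-weighted boundary terms of the Adler identity
   turn the indicators [i + l <= j] and [0 <= l] into (1 + sgn) / 2. *)
Lemma adler_rhs_sgn i j l : adler_rhs S u i j l =
  (2%:R : F)^-1 *:
    ((sgn_coef i j l)%:~R * (u (i + l) * aut_pow S l (u (j - l)))
     + (diag_coef i j l)%:~R * (u j * aut_pow S l (u i))).
Proof.
apply: (scalerI two_neq0); rewrite adler_rhsE scalerBr !scalerA divff //.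
rewrite !scale1r scaler_nat -mulrBl.
set X := u (i + l) * _; set Y := u j * _.
(* The monomials [X] and [Y] coincide for l = j - i and for l = 0. These two indicators can thus be
   moved from [Y] to [X], where they turn the step functions into signs; [l = j] - [l = -i] is what
   remains on [Y]. *)
have XY : (l == j - i)%R%:R * X = (l == j - i)%R%:R * Y.
  case: eqP => [e|]; rewrite ?mul0r // !mul1r /X /Y.
  by congr (u _ * aut_pow _ _ (u _)); lia.
have XY0 : (l == 0)%R%:R * X = (l == 0)%R%:R * Y.
  case: eqP => [e|]; rewrite ?mul0r // !mul1r /X /Y e addr0 subr0.
  by rewrite mulrC.
have c1 : 2%:R * ((i + l <= j)%R%:R : V) - (l == j - i)%R%:R =
    1 + (sgz (j - i - l))%:~R.
  have [h|h|h] := sgzP (j - i - l).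
  - have -> : i + l <= j by lia.
    have -> : l == j - i by lia.
    by rewrite /=; ring.
  - have -> : i + l <= j by lia.
    have -> : (l == j - i) = false by lia.
    by rewrite /=; ring.
  - have -> : (i + l <= j) = false by lia.
    have -> : (l == j - i) = false by lia.
    by rewrite /=; ring.
have c2 : 2%:R * ((0 <= l)%R%:R : V) - (l == 0)%R%:R = 1 + (sgz l)%:~R.
  by have [h|h|h] := sgzP l; rewrite /=; ring.
rewrite /sgn_coef /diag_coef !rmorphB /= -!pmulrn.
have {c1}-> : (sgz (j - i - l))%:~R =
    2%:R * ((i + l <= j)%R%:R : V) - (l == j - i)%R%:R - 1.
  by rewrite c1; ring.
have {c2}-> : (sgz l)%:~R = 2%:R * ((0 <= l)%R%:R : V) - (l == 0)%R%:R - 1.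
  by rewrite c2; ring.
by rewrite !mulrBl XY XY0; ring.
Qed.

End AdlerFormula.

(** * Skewsymmetry and Jacobi identity on the coefficients of L *)

Section Generators.
Variables (F : fieldType) (V : comAlgType F) (S : algAut V).
Variables (br : V -> V -> laurent V) (br_lambda : is_lambda_bracket S br).
Variables (u : int -> V) (h : F).
Hypothesis br_gen : forall i j l : int, br (u i) (u j) l = h *:
  ((sgn_coef i j l)%:~R * (u (i + l) * aut_pow S l (u (j - l)))
   + (diag_coef i j l)%:~R * (u j * aut_pow S l (u i))).

Local Notation c := sgn_coef.
Local Notation t := diag_coef.
Local Notation "x ^[ n ]" := (aut_pow S n x) (at level 2, format "x ^[ n ]").

Lemma br_intr z a b (n : int) : br a (z%:~R * b) n = z%:~R * br a b n.
Proof.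
have e (x : V) : z%:~R * x = z%:~R *: x by rewrite scaler_int mulrzl.
by rewrite !e (brZr br_lambda).
Qed.

Lemma br_intl z a b (n : int) : br (z%:~R * a) b n = z%:~R * br a b n.
Proof.
have e (x : V) : z%:~R * x = z%:~R *: x by rewrite scaler_int mulrzl.
by rewrite !e (brZl br_lambda).
Qed.

(** Exchanging i with j and l with -l negates both coefficients, while applying S^l swaps the two
    factors of each monomial. *)
Lemma br_gen_skew i j (l : int) :
  br (u j) (u i) l = - (br (u i) (u j) (- l))^[l].
Proof.
rewrite !br_gen linearZ -scalerN /=; congr (_ *: _).
rewrite (rmorphD (aut_pow S l)) !(rmorphM (aut_pow S l)) !rmorph_int /=.
rewrite -!aut_powD subrr !aut_pow0 opprK.
have -> : c i j (- l) = - c j i l.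
  rewrite /sgn_coef; have -> : j - i - - l = - (i - j - l) by ring.
  by rewrite !sgzN; ring.
have -> : t i j (- l) = - t j i l by rewrite /diag_coef; lia.
by ring.
Qed.

(** These monomials are the ones occurring in {u_j _lambda u_k}. Writing the scalar as [h%:A] places
    it inside [V], where [ring] can handle it. *)
Lemma br_gen_monomr i a b (m n : int) : br (u i) (u a * (u b)^[n]) m = h%:A *
  ((c i a m)%:~R * (u (i + m) * (u (a - m))^[m] * (u b)^[n])
   + (t i a m)%:~R * (u a * (u i)^[m] * (u b)^[n])
   + (c i b (m - n))%:~R * (u a * (u (i + m - n))^[n] * (u (b + n - m))^[m])
   + (t i b (m - n))%:~R * (u a * (u b)^[n] * (u i)^[m])).
Proof.
rewrite (br_leibnizl br_lambda) (br_aut_powr br_lambda) !br_gen linearZ /=.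
rewrite (rmorphD (aut_pow S n)) !(rmorphM (aut_pow S n)) !rmorph_int /=.
rewrite -!aut_powD -2![h *: (_ + _)]mulr_algl.
have -> : n + (m - n) = m by ring.
have -> : i + (m - n) = i + m - n by ring.
have -> : b - (m - n) = b + n - m by ring.
by ring.
Qed.

Lemma br_monoml_gen a b k (n p : int) : br (u a * (u b)^[p]) (u k) n = h%:A *
  ((c a k n)%:~R * (u (a + n) * (u (k - n))^[n] * (u b)^[n + p])
   + (t a k n)%:~R * (u k * (u a)^[n] * (u b)^[n + p])
   + (c b k (n + p))%:~R *
       (u (b + n + p) * (u (k - n - p))^[n + p] * (u a)^[n])
   + (t b k (n + p))%:~R * (u k * (u b)^[n + p] * (u a)^[n])).
Proof.
rewrite (br_leibnizr br_lambda) (br_aut_powl br_lambda) !br_gen.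
rewrite -2![h *: (_ + _)]mulr_algl -!aut_powD.
have -> : b + (n + p) = b + n + p by ring.
have -> : k - (n + p) = k - n - p by ring.
by ring.
Qed.

(** The six monomials are arranged so that exchanging (i, m) with (j, n) swaps the first with the
    second and the third with the fourth, and only permutes factors in the last two. *)
Lemma br_gen_br_gen i j k (m n : int) : br (u i) (br (u j) (u k) n) m =
  h%:A * h%:A *
  ((c j k n * c i (j + n) m)%:~R
     * (u (i + m) * (u (j + n - m))^[m] * (u (k - n))^[n])
   + (c j k n * c i (k - n) (m - n))%:~R
     * (u (j + n) * (u (i + m - n))^[n] * (u (k - m))^[m])
   + (c j k n * (t i (j + n) m + t i (k - n) (m - n)))%:~R
     * (u (j + n) * (u (k - n))^[n] * (u i)^[m])
   + (t j k n * c i k m)%:~R * (u (i + m) * (u (k - m))^[m] * (u j)^[n])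
   + (t j k n * c i j (m - n))%:~R
     * (u k * (u (i + m - n))^[n] * (u (j + n - m))^[m])
   + (t j k n * (t i k m + t i j (m - n)))%:~R
     * (u k * (u i)^[m] * (u j)^[n])).
Proof.
rewrite br_gen (brZr br_lambda) (brDr br_lambda) !br_intr !br_gen_monomr.
have -> : k - n + n - m = k - m by ring.
by rewrite -[h *: (_ + _)]mulr_algl; ring.
Qed.

Lemma br_br_gen_gen i j k (m n : int) : br (br (u i) (u j) (m - n)) (u k) n =
  h%:A * h%:A *
  ((c i j (m - n) * c (i + m - n) k n)%:~R
     * (u (i + m) * (u (j + n - m))^[m] * (u (k - n))^[n])
   + (c i j (m - n) * c (j + n - m) k m)%:~R
     * (u (j + n) * (u (i + m - n))^[n] * (u (k - m))^[m])
   + (t i j (m - n) * c j k n)%:~R * (u (j + n) * (u (k - n))^[n] * (u i)^[m])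
   + (t i j (m - n) * c i k m)%:~R * (u (i + m) * (u (k - m))^[m] * (u j)^[n])
   + (c i j (m - n) * (t (i + m - n) k n + t (j + n - m) k m))%:~R
     * (u k * (u (i + m - n))^[n] * (u (j + n - m))^[m])
   + (t i j (m - n) * (t j k n + t i k m))%:~R
     * (u k * (u i)^[m] * (u j)^[n])).
Proof.
rewrite br_gen (brZl br_lambda) (brDl br_lambda) !br_intl !br_monoml_gen.
have -> : n + (m - n) = m by ring.
have -> : i + (m - n) = i + m - n by ring.
have -> : j - (m - n) = j + n - m by ring.
have -> : i + m - n + n = i + m by ring.
have -> : j + n - m + n + (m - n) = j + n by ring.
have -> : i + n + (m - n) = i + m by ring.
have -> : k - n - (m - n) = k - m by ring.
by rewrite -[h *: (_ + _)]mulr_algl; ring.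
Qed.

(** A limit of the addition formula coth(x + y) (coth x + coth y) = 1 + coth x coth y; the
    convention sgn 0 = 0 spoils it only at x = y = 0. *)
Lemma sgz_cocycle (x y : int) :
  sgz x * sgz y - sgz (x + y) * (sgz x + sgz y) =
  ((x == 0) && (y == 0))%:Z - 1.
Proof.
by case: (sgzP x) => hx; case: (sgzP y) => hy; case: (sgzP (x + y)) => hxy; lia.
Qed.

(** After expansion the mixed products cancel. What is left is the cocycle identity at (k - j - n, j
    + n - i - m) minus the one at (n, m - n), so that the constants -1 cancel too. *)
Lemma sgn_coef_jacobi i j k (m n : int) :
  c j k n * c i (j + n) m - c i k m * c j (k - m) (n - m)
    - c i j (m - n) * c (i + m - n) k n =
  ((k == j + n) && (j + n == i + m))%:Z - ((n == 0) && (m == 0))%:Z.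
Proof.
have := sgz_cocycle (k - j - n) (j + n - i - m).
have := sgz_cocycle n (m - n).
rewrite /sgn_coef.
have -> : k - j - n + (j + n - i - m) = k - i - m by ring.
have -> : n + (m - n) = m by ring.
have -> : j - i - (m - n) = j + n - i - m by ring.
have -> : k - m - j - (n - m) = k - j - n by ring.
have -> : k - (i + m - n) - n = k - i - m by ring.
have -> : n - m = - (m - n) by ring.
rewrite sgzN => e1 e2.
have -> : (k == j + n) && (j + n == i + m) =
    (k - j - n == 0) && (j + n - i - m == 0) by lia.
have -> : (n == 0) && (m == 0) = (n == 0) && (m - n == 0) by lia.
lia.
Qed.

Lemma br_gen_jacobi i j k (m n : int) :
  br (u i) (br (u j) (u k) n) m - br (u j) (br (u i) (u k) m) n =
  br (br (u i) (u j) (m - n)) (u k) n.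
Proof.
(* All terms share the factor h^2; the cubic expressions remain to be compared. *)
rewrite !br_gen_br_gen br_br_gen_gen -mulrBr; congr (_ * _).
set X := u (i + m) * _ * _; set Y := u (j + n) * _ * _.
set P := u (j + n) * _ * _; set Q := u (i + m) * _ * _.
set R := u k * _ * _; set Z := u k * _ * _.
have -> : u k * (u (j + n - m))^[m] * (u (i + m - n))^[n] = R.
  by rewrite mulrAC.
have -> : u k * (u j)^[n] * (u i)^[m] = Z by rewrite mulrAC.
(* The defect left on [X]; the defect on [Y] will be its opposite. *)
pose d : int := ((k == j + n) && (j + n == i + m))%:Z
                - ((n == 0) && (m == 0))%:Z.
have dXY : d%:~R * X = d%:~R * Y.
  (* If k = j + n = i + m, both monomials are u_k S^m(u_i) S^n(u_j); if m = n = 0, both are u_i u_j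
     u_k. Otherwise d = 0. *)
  have [/andP[/eqP ek /eqP e]|ne] := boolP ((k == j + n) && (j + n == i + m)).
    congr (_ * _); rewrite /X /Y mulrAC ek -e.
    have -> : j + n - m = i by rewrite e; ring.
    by have -> : j + n - n = j by ring.
  have [/andP[/eqP en /eqP em]|ne'] := boolP ((n == 0) && (m == 0)).
    congr (_ * _); rewrite /X /Y en em !subr0 ?addr0 !aut_pow0.
    by rewrite [u i * u j]mulrC.
  by rewrite /d (negbTE ne) (negbTE ne') subrr !mul0r.
have cN : c j i (n - m) = - c i j (m - n).
  rewrite /sgn_coef; have -> : i - j - (n - m) = - (j - i - (m - n)) by ring.
  by rewrite -[n - m]opprB !sgzN; ring.
have tN : t j i (n - m) = - t i j (m - n) by rewrite /diag_coef; lia.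
have eX := sgn_coef_jacobi i j k m n.
(* The same identity after exchanging (i, m) with (j, n), under which d is symmetric. *)
have eY : c i k m * c j (i + m) n - c j k n * c i (k - n) (m - n)
          - c j i (n - m) * c (j + n - m) k m = d.
  by rewrite sgn_coef_jacobi /d; lia.
(* Additive relations between the indicators make [P], [Q] and [R] cancel exactly. *)
have eP : t i (j + n) m = t i k m + t i j (m - n) - t i (k - n) (m - n).
  by rewrite /diag_coef; lia.
have eQ : t j (i + m) n = t j k n - t j (k - m) (n - m) - t i j (m - n).
  by rewrite /diag_coef; lia.
have eR : t (i + m - n) k n = t j k n + t i k m - t (j + n - m) k m.
  by rewrite /diag_coef; lia.
rewrite -/d in eX; rewrite cN in eY *; rewrite tN eP eQ eR.
have {eX}-> : c j k n * c i (j + n) m = d + c i k m * c j (k - m) (n - m)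
    + c i j (m - n) * c (i + m - n) k n by rewrite -eX; ring.
have {eY}-> : c i k m * c j (i + m) n = d + c j k n * c i (k - n) (m - n)
    - c i j (m - n) * c (j + n - m) k m by rewrite -eY; ring.
apply/subr0_eq; transitivity (d%:~R * X - d%:~R * Y); last first.
  by rewrite dXY subrr.
by ring.
Qed.

End Generators.

(** * From the coefficients of L to the subalgebra they generate *)

Section Extension.
Variables (F : fieldType) (V : comAlgType F) (S : algAut V).
Variables (br : V -> V -> laurent V) (br_lambda : is_lambda_bracket S br).
Variable u : int -> V.
Local Notation U := (gen_subalg S u).

Lemma mem_gen_subalg_coef n : u n \in U.
Proof. by apply/gen_subalgP => A [_ _]. Qed.

Lemma mem_gen_subalg_aut_pow n x : x \in U -> aut_pow S n x \in U.
Proof.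
move=> xU; pattern (aut_pow S n); apply: aut_pow_ind => //= f fU.
  by rewrite gen_subalg_S.
by rewrite gen_subalg_Sinv.
Qed.

(** Minimality of [U]: its elements satisfying [P] form a competing subalgebra. The clause on [S] is
    an equivalence because stability means S(A) = A, so it also covers the inverse of [S]. *)
Lemma gen_subalg_ind (P : V -> Prop) :
    P 1 ->
    (forall k x y, x \in U -> y \in U -> P x -> P y -> P (k *: x + y)) ->
    (forall x y, x \in U -> y \in U -> P x -> P y -> P (x * y)) ->
    (forall x, P (S x) <-> P x) -> (forall n, P (u n)) ->
  forall x, x \in U -> P x.
Proof.
move=> P1 PZD PM PS Pu x /gen_subalgP xA.
pose A : {pred V} := fun x => (x \in U) && `[< P x >].
have AP y : reflect (y \in U /\ P y) (y \in A).
  apply: (iffP andP) => [[yU /asboolP]|[yU Py]]; first by [].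
  by split=> //; apply/asboolP.
suff /xA/AP[] : S_subalg_containing S u A by [].
split=> [|y|n].
- split; first by apply/AP; rewrite rpred1.
    move=> k y z /AP[yU Py] /AP[zU Pz]; apply/AP.
    by split; [rewrite rpredD ?rpredZ|exact: PZD].
  move=> y z /AP[yU Py] /AP[zU Pz]; apply/AP.
  by split; [rewrite rpredM|exact: PM].
- by apply/AP/AP; rewrite gen_subalg_S PS.
- by apply/AP; split; [exact: mem_gen_subalg_coef|].
Qed.

(** Induction on the first argument, then on the second, one Leibniz rule for each. The degree stays
    quantified because sesquilinearity shifts it. *)
Lemma br_gen_subalg a b (n : int) :
  (forall i j (l : int), br (u i) (u j) l \in U) ->
  a \in U -> b \in U -> br a b n \in U.
Proof.
move=> uU aU bU; move: a aU n; apply: gen_subalg_ind =>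
  [n|k x y _ _ xU yU n|x y xU yU xbU ybU n|x|i].
- by rewrite (br1l br_lambda) rpred0.
- by rewrite (br_linearl br_lambda) rpredD ?rpredZ.
- by rewrite (br_leibnizr br_lambda) rpredD ?rpredM ?mem_gen_subalg_aut_pow.
- split=> xU n; last by rewrite (br_sesquil br_lambda).
  by rewrite -(subrK 1 n) -(br_sesquil br_lambda).
move: b bU; apply: gen_subalg_ind =>
  [n|k x y _ _ xU yU n|x y xU yU xbU ybU n|x|j n] //.
- by rewrite (br1r br_lambda) rpred0.
- by rewrite (br_linearr br_lambda) rpredD ?rpredZ.
- by rewrite (br_leibnizl br_lambda) rpredD ?rpredM.
- split=> xU n; last by rewrite (br_sesquir br_lambda) gen_subalg_S.
  by have := xU (n + 1); rewrite (br_sesquir br_lambda) gen_subalg_S addrK.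
Qed.

Definition skew_at a b := forall n : int,
  br b a n = - aut_pow S n (br a b (- n)).

Lemma skew_at_sym a b : skew_at a b -> skew_at b a.
Proof.
by move=> ab n; rewrite ab opprK raddfN /= opprK -aut_powD subrr aut_pow0.
Qed.

(** Applying S^n to the left Leibniz rule produces exactly the factors S^n of the right one, so
    products are preserved. *)
Lemma skew_at_gen_subalg a b :
  (forall n, skew_at a (u n)) -> b \in U -> skew_at a b.
Proof.
move=> au; move: b; apply: gen_subalg_ind =>
  [n|k x y _ _ xU yU n|x y _ _ xU yU n|x|//].
- by rewrite (br1l br_lambda) (br1r br_lambda) raddf0 oppr0.
- rewrite (br_linearl br_lambda) (br_linearr br_lambda) xU yU linearP /=.
  by rewrite opprD scalerN.
- rewrite (br_leibnizr br_lambda) (br_leibnizl br_lambda) xU yU.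
  by rewrite (rmorphD (aut_pow S n)) !(rmorphM (aut_pow S n)) opprD !mulNr.
- have e n : - aut_pow S n (br a (S x) (- n)) =
             - aut_pow S (n + 1) (br a x (- (n + 1))).
    by rewrite (br_sesquir br_lambda) aut_powD opprD.
  split=> xU n; last by rewrite (br_sesquil br_lambda) e.
  by rewrite -(subrK 1 n) -(br_sesquil br_lambda) xU e.
Qed.

Definition jacobi_at a b c := forall m n : int,
  br a (br b c n) m - br b (br a c m) n = br (br a b (m - n)) c n.

(** The exchange negates the left side. On the right, skewsymmetry puts S^(m - n) in the first
    argument, and sesquilinearity absorbs it by raising the degree from n to m. *)
Lemma jacobi_at_swap a b c :
  skew_at a b -> jacobi_at a b c -> jacobi_at b a c.
Proof.
move=> ab J m n; rewrite -[LHS]opprB J ab.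
rewrite (brNl br_lambda) (br_aut_powl br_lambda) opprB.
by have -> : n + (m - n) = m by ring.
Qed.

(** Both sides are derivations in [c], a commutator of derivations being one; replacing [c] by [S c]
    shifts m and n together and keeps m - n. *)
Lemma jacobi_at_gen_subalgr a b c :
  (forall n, jacobi_at a b (u n)) -> c \in U -> jacobi_at a b c.
Proof.
move=> abu; move: c; apply: gen_subalg_ind =>
  [m n|k x y _ _ xU yU m n|x y _ _ xU yU m n|x|//].
- by rewrite !(br1r br_lambda) !(br0r br_lambda) subrr.
- by rewrite !(br_linearr br_lambda) -xU -yU scalerBr; ring.
- rewrite !(br_leibnizl br_lambda) !(brDr br_lambda) !(br_leibnizl br_lambda).
  by rewrite -xU -yU; ring.
- have e m n : br a (br b (S x) n) m - br b (br a (S x) m) n =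
      S (br a (br b x (n - 1)) (m - 1) - br b (br a x (m - 1)) (n - 1)).
    by rewrite !(br_sesquir br_lambda) raddfB.
  split=> xU m n; last first.
    by rewrite e xU (br_sesquir br_lambda); congr (S (br (br a b _) _ _)); ring.
  apply: (can_inj (aut_funK S)).
  have := xU (m + 1) (n + 1); rewrite e (br_sesquir br_lambda) !addrK => ->.
  by congr (S (br (br a b _) _ _)); ring.
Qed.

Lemma jacobi_at_gen_subalgl a b c :
  (forall x, x \in U -> skew_at x b) ->
  (forall n, jacobi_at (u n) b c) -> a \in U -> jacobi_at a b c.
Proof.
move=> skb ubc; move: a; apply: gen_subalg_ind =>
  [m n|k x y _ _ xU yU m n|x y xU yU Jx Jy m n|x|//].
- by rewrite !(br1l br_lambda) (br0r br_lambda) (br0l br_lambda) subrr.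
- rewrite !(br_linearl br_lambda) (br_linearr br_lambda).
  by rewrite -xU -yU scalerBr; ring.
(* For a product x y, the cross terms from the left side carry S^m{b, z} and those from the right
   side S^n{z, b}, with z one of the factors; skewsymmetry identifies them. *)
- have e z : z \in U ->
      aut_pow S m (br b z (n - m)) = - aut_pow S n (br z b (m - n)).
    by move=> zU; rewrite (skb z zU) raddfN /= -aut_powD opprB addrC subrK.
  rewrite !(br_leibnizr br_lambda) (brDr br_lambda) !(br_leibnizl br_lambda).
  rewrite (brDl br_lambda) !(br_leibnizr br_lambda).
  rewrite !(br_aut_powr br_lambda) !(br_aut_powl br_lambda) -!aut_powD !e //.
  have -> : n + (m - n) = m by ring.
  by rewrite -Jx -Jy; ring.
- split=> xU m n.
    have := xU (m - 1) n; rewrite !(br_sesquil br_lambda) subrK => ->.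
    by congr (br (br x b _) _ _); ring.
  by rewrite !(br_sesquil br_lambda) xU; congr (br (br x b _) _ _); ring.
Qed.

Lemma skew_gen_subalg a b :
  (forall i j, skew_at (u i) (u j)) -> a \in U -> b \in U -> skew_at a b.
Proof.
move=> sku aU bU; apply: skew_at_gen_subalg bU => j; apply: skew_at_sym.
by apply: skew_at_gen_subalg aU => i; exact: sku.
Qed.

Lemma jacobi_gen_subalg a b c :
  (forall x y, x \in U -> y \in U -> skew_at x y) ->
  (forall i j k, jacobi_at (u i) (u j) (u k)) ->
  a \in U -> b \in U -> c \in U -> jacobi_at a b c.
Proof.
move=> sk Ju aU bU cU; have uU := mem_gen_subalg_coef.
apply: jacobi_at_gen_subalgl aU => [x xU|i]; first exact: sk.
(* With [u i] in first place, the swap brings [b] there, so the same reduction applies to it. *)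
apply: jacobi_at_swap; first exact: sk.
apply: jacobi_at_gen_subalgl bU => [x xU|j]; first exact: sk.
by apply: jacobi_at_gen_subalgr cU => k; exact: Ju.
Qed.

End Extension.

(** * The restricted bracket on the generated subalgebra *)

Section Restriction.
Variables (F : fieldType) (V : comAlgType F) (S : algAut V).
Variables (br : V -> V -> laurent V) (br_lambda : is_lambda_bracket S br).
Variable u : int -> V.
Local Notation U := (gen_subalg S u).
Hypothesis brU : forall a b : V, a \in U -> b \in U ->
  forall n : int, br a b n \in U.

Definition gen_br_coef (a b : gen_type S u) (n : int) : gen_type S u :=
  GenType (brU (valP a) (valP b) n).

(** The finite support of the ambient bracket serves as a bound for the restricted one, making it a
    Laurent polynomial. *)
Definition gen_br (a b : gen_type S u) : laurent (gen_type S u) :=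
  [fsfun n in finsupp (br (val a) (val b)) => gen_br_coef a b n | 0].

Lemma val_gen_br a b (n : int) : val (gen_br a b n) = br (val a) (val b) n.
Proof.
rewrite /gen_br fsfun_fun; case: ifPn => // nU.
by rewrite raddf0; apply/esym; rewrite fsfun_dflt.
Qed.

Lemma val_gen_aut_pow (n : int) a :
  val (aut_pow (gen_aut S u) n a) = aut_pow S n (val a).
Proof.
elim: n a => [|n IHn|n IHn] a //.
  by rewrite -addn1 PoszD !aut_pow_succ /= IHn.
have -> : - n.+1%:Z = - n%:Z - 1 by lia.
by rewrite !aut_pow_pred /= IHn.
Qed.

(** The inclusion into [V] is an injective algebra morphism compatible with [S] and the brackets, so
    every axiom can be checked in [V]. *)
Lemma gen_br_mult_PVA :
  (forall a b, a \in U -> b \in U -> skew_at S br a b) ->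
  (forall a b c, a \in U -> b \in U -> c \in U -> jacobi_at br a b c) ->
  is_mult_PVA (gen_aut S u) gen_br.
Proof.
move=> skU JU.
split=> [|a b n|a b c m n]; first split=>
    [k a a' b n|k a b b' n|a b n|a b n|a b c n|a b c n];
  apply/val_inj.
- by rewrite linearP /= !val_gen_br linearP (br_linearl br_lambda).
- by rewrite linearP /= !val_gen_br linearP (br_linearr br_lambda).
- by rewrite !val_gen_br (br_sesquil br_lambda).
- by rewrite /= !val_gen_br (br_sesquir br_lambda).
- by rewrite rmorphD !rmorphM /= !val_gen_br rmorphM (br_leibnizl br_lambda).
- rewrite rmorphD !rmorphM /= !val_gen_br !val_gen_aut_pow rmorphM.
  by rewrite (br_leibnizr br_lambda).
- by rewrite rmorphN /= val_gen_aut_pow !val_gen_br skU //; exact: valP.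
- by rewrite rmorphB /= !val_gen_br JU //; exact: valP.
Qed.

End Restriction.

Theorem corollary6p3 (F : fieldType) (charF0 : [pchar F] =i pred0)
    (V : comAlgType F) (S : algAut V) (br : V -> V -> laurent V)
    (br_lambda : is_lambda_bracket S br) (u : int -> V)
    (u_laurent : in_laurent_Sinv u \/ in_laurent_S u)
    (u_adler : adler_identity S u br) :
  [/\ forall a b : V, a \in gen_subalg S u -> b \in gen_subalg S u ->
        forall n : int, br a b n \in gen_subalg S u,
      exists2 brU : gen_type S u -> gen_type S u -> laurent (gen_type S u),
        forall a b n, val (brU a b n) = br (val a) (val b) n &
        is_mult_PVA (gen_aut S u) brU
    & (forall x : V, x \in gen_subalg S u) -> is_mult_PVA S br].
Proof.
have two_neq0 : (2%:R : F) != 0 by rewrite ((pcharf0P F).1 charF0 2).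
have br_gen i j (l : int) :=
  etrans (u_adler i j l) (adler_rhs_sgn S u two_neq0 i j l).
have brU a b : a \in gen_subalg S u -> b \in gen_subalg S u ->
    forall n : int, br a b n \in gen_subalg S u.
  move=> aU bU n; apply: br_gen_subalg aU bU => // i j l.
  (* The explicit formula is a combination of products of shifted coefficients of L, all in the
     subalgebra. *)
  by rewrite br_gen rpredZ // rpredD // !rpredM ?rpred_int
     ?mem_gen_subalg_aut_pow ?mem_gen_subalg_coef.
have skU a b : a \in gen_subalg S u -> b \in gen_subalg S u -> skew_at S br a b.
  apply: skew_gen_subalg => // i j l; exact: br_gen_skew br_gen _ _ _.
have JU a b c : a \in gen_subalg S u -> b \in gen_subalg S u ->
    c \in gen_subalg S u -> jacobi_at br a b c.
  apply: jacobi_gen_subalg => // i j k m n.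
  exact: (br_gen_jacobi br_lambda br_gen).
split=> [//||allU].
  exists (gen_br brU); first exact: val_gen_br.
  exact: gen_br_mult_PVA.
split=> // [a b n|a b c m n]; [exact: skU|exact: JU].
Qed.
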